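(* Let $Q$ be a $3$-supernilpotent loop. Then: (i) $L_{a,b}$, $R_{a,b}$, $M_{a,b}$ and $T_{a,b}$ are automorphisms of $Q$ for every $a,b\in Q$. (ii) $L_{a,b}$, $R_{a,b}$, $M_{a,b}$ and $T_{a,b}$ are in the center of the inner mapping group $\mathrm{Inn}(Q)$ for every $a,b\in Q$. (iii) $T_a(bc)=T_a(b)T_a(c)$ for all $a,b,c\in Q$ such that at least one of $b,c$ is a commutator or an associator in $Q$.
   Context: A loop is an algebra $(Q,\cdot,\backslash,/,1)$ in which $1$ is a two-sided identity for $\cdot$, $a\backslash b$ is the unique solution $x$ of $ax=b$, and $b/a$ is the unique solution $x$ of $xa=b$. Let $L_a(u)=au$ and $R_a(u)=ua$. The multiplication group is $\mathrm{Mlt}(Q)=\langle L_a,R_a:a\in Q\rangle$ and the inner mapping group is $\mathrm{Inn}(Q)=\{f\in\mathrm{Mlt}(Q):f(1)=1\}$. For $a,b\in Q$ define elements of $\mathrm{Inn}(Q)$ by $L_{a,b}(u)=(ab)\backslash(a(bu))$, $R_{a,b}(u)=((ua)b)/(ab)$, $M_{a,b}(u)=a\backslash((a(ub))/b)$, $T_a(u)=a\backslash(ua)$, $T_{a,b}(u)=T_a^{-1}T_b^{-1}T_aT_b(u)$. A commutator term is a binary loop term $\llbracket x,y\rrbracket$ such that for all elements $a,b$ of every loop, $\llbracket a,b\rrbracket=1$ if and only if $ab=ba$; an associator term is a ternary loop term $\llbracket x,y,z\rrbracket$ such that for all elements $a,b,c$ of every loop, $\llbracket a,b,c\rrbracket=1$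 if and only if $a(bc)=(ab)c$. A commutator (associator) in $Q$ is a value $\llbracket u,v\rrbracket$ (respectively $\llbracket u,v,w\rrbracket$) of a commutator (associator) term at elements of $Q$. A polynomial on an algebra $A$ is a term in the language of $A$ expanded by all elements of $A$ as constants. An $n$-ary polynomial $p$ on $A$ is absorbing at $(e_1,\dots,e_n)\in A^n$ into $e\in A$ if $p(a_1,\dots,a_n)=e$ whenever $a_1,\dots,a_n\in A$ satisfy $a_i=e_i$ for at least one $i$. The algebra $A$ is $k$-supernilpotent if all polynomials on $A$ in at least $k+1$ variables that are absorbing (at any tuple and into any element) are constant (as functions). *)

(* Defs.v *)
From mathcomp Require Import all_boot.

Set Implicit Arguments.
Unset Strict Implicit.
Unset Printing Implicit Defensive.

Declare Scope loop_scope.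
Delimit Scope loop_scope with L.

Record loop : Type := Loop {
  carrier :> Type;
  mul : carrier -> carrier -> carrier;
  ldiv : carrier -> carrier -> carrier;
  rdiv : carrier -> carrier -> carrier;
  one : carrier;
  mul1l : forall x, mul one x = x;
  mull1 : forall x, mul x one = x;
  ldivP : forall a b, unique (fun x => mul a x = b) (ldiv a b);
  rdivP : forall b a, unique (fun x => mul x a = b) (rdiv b a)
}.

Arguments mul {l}.
Arguments ldiv {l}.
Arguments rdiv {l}.
Arguments one {l}.

Notation "x * y" := (mul x y) : loop_scope.
Notation "x \ y" := (ldiv x y) (at level 40, left associativity) : loop_scope.
Notation "x / y" := (rdiv x y) : loop_scope.
Notation "1" := one : loop_scope.

Local Open Scope loop_scope.

(* Terms in n variables in the language of loops expanded by a type C of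
   constant symbols: C = void gives loop terms, C = Q polynomials on Q. *)
Inductive term (C : Type) (n : nat) : Type :=
| Var of 'I_n
| Cst of C
| One
| Mul of term C n & term C n
| LDiv of term C n & term C n
| RDiv of term C n & term C n.

Arguments One {C n}.

Fixpoint eval (Q : loop) (C : Type) (c : C -> Q) (n : nat) (v : n.-tuple Q)
    (t : term C n) : Q :=
  match t with
  | Var i => tnth v i
  | Cst x => c x
  | One => 1
  | Mul t1 t2 => eval c v t1 * eval c v t2
  | LDiv t1 t2 => eval c v t1 \ eval c v t2
  | RDiv t1 t2 => eval c v t1 / eval c v t2
  end.

Definition loop_term (n : nat) : Type := term void n.

Definition term_value (Q : loop) (n : nat) (t : loop_term n) (v : n.-tuple Q) : Q :=
  eval (of_void Q) v t.

Definition polynomial (Q : loop) (n : nat) : Type := term Q n.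

Definition poly_value (Q : loop) (n : nat) (p : polynomial Q n) (v : n.-tuple Q) : Q :=
  eval id v p.

Definition absorbing (Q : loop) (n : nat) (p : polynomial Q n)
    (e : n.-tuple Q) (e0 : Q) : Prop :=
  forall v : n.-tuple Q, (exists i, tnth v i = tnth e i) -> poly_value p v = e0.

Definition supernilpotent (k : nat) (Q : loop) : Prop :=
  forall (n : nat) (p : polynomial Q n), k.+1 <= n ->
    (exists e e0, absorbing p e e0) ->
    forall v w : n.-tuple Q, poly_value p v = poly_value p w.

Definition commutator_term (t : loop_term 2) : Prop :=
  forall (Q : loop) (a b : Q), term_value t [tuple a; b] = 1 <-> a * b = b * a.

Definition associator_term (t : loop_term 3) : Prop :=
  forall (Q : loop) (a b c : Q),
    term_value t [tuple a; b; c] = 1 <-> a * (b * c) = (a * b) * c.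

Definition is_commutator (Q : loop) (x : Q) : Prop :=
  exists2 t, commutator_term t & exists u v : Q, x = term_value t [tuple u; v].

Definition is_associator (Q : loop) (x : Q) : Prop :=
  exists2 t, associator_term t &
    exists u v w : Q, x = term_value t [tuple u; v; w].

(* The subgroup of Sym(Q) generated by all translations, its elements being
   represented by their underlying functions. The rule for inverses makes the
   predicate invariant under pointwise equality. *)
Inductive Mlt (Q : loop) : (Q -> Q) -> Prop :=
| Mlt_L a : Mlt (fun u => a * u)
| Mlt_R a : Mlt (fun u => u * a)
| Mlt_id : Mlt id
| Mlt_comp f g : Mlt f -> Mlt g -> Mlt (f \o g)
| Mlt_inv f g : Mlt f -> cancel f g -> cancel g f -> Mlt g.

Definition Inn (Q : loop) (f : Q -> Q) : Prop := Mlt f /\ f 1 = 1.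

Definition center_Inn (Q : loop) (f : Q -> Q) : Prop :=
  Inn f /\ forall g : Q -> Q, Inn g -> f \o g =1 g \o f.

Definition automorphism (Q : loop) (f : Q -> Q) : Prop :=
  [/\ bijective f, f 1 = 1, {morph f : x y / x * y},
      {morph f : x y / x \ y} & {morph f : x y / x / y}].

Definition innL (Q : loop) (a b u : Q) : Q := (a * b) \ (a * (b * u)).
Definition innR (Q : loop) (a b u : Q) : Q := ((u * a) * b) / (a * b).
Definition innM (Q : loop) (a b u : Q) : Q := a \ ((a * (u * b)) / b).
Definition innT (Q : loop) (a u : Q) : Q := a \ (u * a).

Definition innTinv (Q : loop) (a u : Q) : Q := (a * u) / a.

Lemma innTK (Q : loop) (a : Q) : cancel (innT a) (innTinv a).
Proof.
move=> u; rewrite /innTinv /innT (proj1 (ldivP a (u * a))).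
exact: (proj2 (rdivP (u * a) a)).
Qed.

Lemma innTinvK (Q : loop) (a : Q) : cancel (innTinv a) (innT a).
Proof.
move=> u; rewrite /innTinv /innT (proj1 (rdivP (a * u) a)).
exact: (proj2 (ldivP a (a * u))).
Qed.

Definition innTT (Q : loop) (a b u : Q) : Q :=
  innTinv a (innTinv b (innT a (innT b u))).

(* Main.v *)
Require Import Defs.
From mathcomp Require Import all_boot.

(** Each assertion says that two polynomials in four variables agree, and these
two polynomials already agree as soon as one variable equals [1]. Their quotient
is then absorbing at [(1, 1, 1, 1)] into [1], hence constant by 3-supernilpotence.
For centrality, [Mlt_commute_shift] reduces commutation with all of [Inn Q] to
commutation with the maps [u |-> (c * d) \ (c * (d * u))] and
[u |-> (d * c) \ ((d * u) * c)], in which only [c] and [u] are treated as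
variables and [d] as a constant. *)

Set Implicit Arguments.
Unset Strict Implicit.
Unset Printing Implicit Defensive.

Local Open Scope loop_scope.

Section LoopTheory.

Variable Q : loop.
Implicit Types a b c u x y : Q.

(** * Cancellation laws in a loop *)

Lemma mulKl a b : a * (a \ b) = b.
Proof. exact: (proj1 (ldivP a b)). Qed.

Lemma divKr a b : (b / a) * a = b.
Proof. exact: (proj1 (rdivP b a)). Qed.

Lemma ldiv_eq a b x : a * x = b -> a \ b = x.
Proof. exact: (proj2 (ldivP a b)). Qed.

Lemma rdiv_eq a b x : x * a = b -> b / a = x.
Proof. exact: (proj2 (rdivP b a)). Qed.

Lemma ldivK a b : a \ (a * b) = b.
Proof. exact: ldiv_eq. Qed.

Lemma rdivK a b : (b * a) / a = b.
Proof. exact: rdiv_eq. Qed.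

Lemma ldivxx a : a \ a = 1.
Proof. exact/ldiv_eq/mull1. Qed.

Lemma rdivxx a : a / a = 1.
Proof. exact/rdiv_eq/mul1l. Qed.

Lemma ldiv1l a : 1 \ a = a.
Proof. exact/ldiv_eq/mul1l. Qed.

Lemma rdiv1r a : a / 1 = a.
Proof. exact/rdiv_eq/mull1. Qed.

(** Simplification rules for the boundary cases, where some variable is [1]. *)
Definition loopE := (mul1l, mull1, ldivK, rdivK, ldivxx, rdivxx, ldiv1l, rdiv1r).

(** * Members of the multiplication group *)

Lemma Mlt_bij (f : Q -> Q) :
  Mlt f -> exists g : Q -> Q, [/\ Mlt g, cancel f g & cancel g f].
Proof.
have inv f0 g : Mlt f0 -> cancel f0 g -> cancel g f0 ->
  exists g0 : Q -> Q, [/\ Mlt g0, cancel f0 g0 & cancel g0 f0].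
  by move=> Mf fK gK; exists g; split=> //; apply: (Mlt_inv Mf).
elim=> {f} [a|a||f g _ [f' [Mf fK f'K]] _ [g' [Mg gK g'K]]|f g Mf _ fK gK].
- by apply: (inv _ (ldiv a)); [apply: Mlt_L | move=> u; rewrite loopE |
    move=> u; rewrite mulKl].
- by apply: (inv _ (fun u => u / a)); [apply: Mlt_R | move=> u; rewrite loopE |
    move=> u; rewrite divKr].
- by exists id; split=> //; apply: Mlt_id.
- by exists (g' \o f'); split; [apply: Mlt_comp | apply: can_comp |
    apply: can_comp].
- by exists f.
Qed.

Lemma Mlt_ldiv a : Mlt (fun u => a \ u).
Proof.
by apply: (Mlt_inv (Mlt_L a)) => u; [rewrite loopE | rewrite mulKl].
Qed.

Lemma Mlt_rdiv a : Mlt (fun u => u / a).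
Proof.
by apply: (Mlt_inv (Mlt_R a)) => u; [rewrite loopE | rewrite divKr].
Qed.

Lemma Mlt_innL a b : Mlt (innL a b).
Proof. exact: Mlt_comp (Mlt_ldiv _) (Mlt_comp (Mlt_L a) (Mlt_L b)). Qed.

Lemma Mlt_innR a b : Mlt (innR a b).
Proof. exact: Mlt_comp (Mlt_rdiv _) (Mlt_comp (Mlt_R b) (Mlt_R a)). Qed.

Lemma Mlt_innM a b : Mlt (innM a b).
Proof.
exact: Mlt_comp (Mlt_ldiv a)
  (Mlt_comp (Mlt_rdiv b) (Mlt_comp (Mlt_L a) (Mlt_R b))).
Qed.

Lemma Mlt_innT a : Mlt (innT a).
Proof. exact: Mlt_comp (Mlt_ldiv a) (Mlt_R a). Qed.

Lemma Mlt_innTinv a : Mlt (innTinv a).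
Proof. exact: Mlt_comp (Mlt_rdiv a) (Mlt_L a). Qed.

Lemma Mlt_innTT a b : Mlt (innTT a b).
Proof.
exact: Mlt_comp (Mlt_innTinv a)
  (Mlt_comp (Mlt_innTinv b) (Mlt_comp (Mlt_innT a) (Mlt_innT b))).
Qed.

(* The maps [L_(h a)^-1 h L_a], unlike [L_(h 1)^-1 h], compose when [h] does. *)
Lemma Mlt_commute_shift (f h : Q -> Q) :
    (forall a c u, f ((a * c) \ (a * (c * u))) = (a * c) \ (a * (c * f u))) ->
    (forall a c u, f ((a * c) \ ((a * u) * c)) = (a * c) \ ((a * f u) * c)) ->
    Mlt h ->
  forall a u, f (h a \ h (a * u)) = h a \ h (a * f u).
Proof.
move=> fL fR; elim=> {h} [c a u|c a u|a u|g h _ IHg _ IHh a u|h g _ IH hK gK a u] /=.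
- exact: fL.
- exact: fR.
- by rewrite !ldivK.
(* The shifted map of [g \o h] at [a] is that of [g] at [h a] after that of [h] at [a]. *)
- by have := IHg (h a) (h a \ h (a * u)); rewrite mulKl IHh mulKl.
(* At base point [g a] the shifted map of [h] undoes that of [g] at [a], so it sends this argument
   to [u]. *)
- have /(congr1 (fun z => a * z)) := IH (g a) (g a \ g (a * u)).
  rewrite mulKl !gK ldivK mulKl => /(congr1 g).
  by rewrite hK => ->; rewrite ldivK.
Qed.

Lemma automorphism_morph (f : Q -> Q) :
  bijective f -> {morph f : x y / x * y} -> automorphism f.
Proof.
move=> bij_f fM; have fV x y : f (x \ y) = f x \ f y.
  by apply/esym/ldiv_eq; rewrite -fM mulKl.
split=> //; first by rewrite -(ldivxx 1) fV !ldivxx.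
move=> x y.
by apply/esym/rdiv_eq; rewrite -fM divKr.
Qed.

(** * Polynomial functions, taken up to pointwise equality *)

Definition is_polynomial n (f : n.-tuple Q -> Q) : Prop :=
  exists p : polynomial Q n, poly_value p =1 f.

Lemma is_polynomial_var n (i : 'I_n) :
  is_polynomial (fun v : n.-tuple Q => tnth v i).
Proof. by exists (Var Q i). Qed.

Lemma is_polynomial_cst n a : is_polynomial (fun _ : n.-tuple Q => a).
Proof. by exists (Cst n a). Qed.

Lemma is_polynomial_mul n (f g : n.-tuple Q -> Q) :
  is_polynomial f -> is_polynomial g -> is_polynomial (fun v => f v * g v).
Proof.
by move=> [p pE] [q qE]; exists (Mul p q) => v; rewrite -pE -qE.
Qed.

Lemma is_polynomial_ldiv n (f g : n.-tuple Q -> Q) :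
  is_polynomial f -> is_polynomial g -> is_polynomial (fun v => f v \ g v).
Proof.
by move=> [p pE] [q qE]; exists (LDiv p q) => v; rewrite -pE -qE.
Qed.

Lemma is_polynomial_rdiv n (f g : n.-tuple Q -> Q) :
  is_polynomial f -> is_polynomial g -> is_polynomial (fun v => f v / g v).
Proof.
by move=> [p pE] [q qE]; exists (RDiv p q) => v; rewrite -pE -qE.
Qed.

Lemma is_polynomial_term_value n m (t : loop_term m)
    (w : n.-tuple Q -> m.-tuple Q) :
  (forall i, is_polynomial (fun v => tnth (w v) i)) ->
  is_polynomial (fun v => term_value t (w v)).
Proof.
move=> pw; elim: t => [i|[]||t1 p1 t2 p2|t1 p1 t2 p2|t1 p1 t2 p2].
- exact: pw.
- exact: is_polynomial_cst.
- exact: is_polynomial_mul p1 p2.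
- exact: is_polynomial_ldiv p1 p2.
- exact: is_polynomial_rdiv p1 p2.
Qed.

(** Phrased as closure under substitution, since [F] occurs nested inside larger polynomials. *)
Definition polynomial_op3 (F : Q -> Q -> Q -> Q) : Prop :=
  forall n (f g h : n.-tuple Q -> Q),
    is_polynomial f -> is_polynomial g -> is_polynomial h ->
  is_polynomial (fun v => F (f v) (g v) (h v)).

End LoopTheory.

Ltac polynomiality :=
  repeat first [ assumption | apply: is_polynomial_var
    | apply: is_polynomial_cst | apply: is_polynomial_mul
    | apply: is_polynomial_ldiv | apply: is_polynomial_rdiv ].

Section Supernilpotent3.

Variable Q : loop.
Hypothesis Q3 : supernilpotent 3 Q.
Implicit Types a b c d u x y : Q.

(** The quotient [f / g] is absorbing at the all-ones tuple into [1]; being constant, it equals [1]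
    everywhere. *)
Lemma supernilpotent_eq k n (f g : n.-tuple Q -> Q) :
    supernilpotent k Q -> k < n -> is_polynomial f -> is_polynomial g ->
    (forall v i, tnth v i = 1 -> f v = g v) ->
  f =1 g.
Proof.
move=> Qk lt_kn pf pg eq_fg v.
have [p pE] := is_polynomial_rdiv pf pg.
have abs_p : absorbing p [tuple of nseq n 1] 1.
  move=> w [i]; rewrite tnth_nseq => /eq_fg.
  by rewrite pE => ->; apply: rdivxx.
have := Qk n p lt_kn (ex_intro _ _ (ex_intro _ _ abs_p)) v [tuple of nseq n 1].
(* Absorption needs an index where the tuples agree; index [0] exists because [k < n]. *)
rewrite [RHS]abs_p; last by exists (Ordinal (leq_trans (ltn0Sn k) lt_kn)).
by rewrite pE => /(congr1 (fun z => z * g v)); rewrite divKr mul1l.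
Qed.

(** Curried form for four variables, which splits the boundary condition into four identities. *)
Lemma supernilpotent3_eq (f g : Q -> Q -> Q -> Q -> Q) :
    let at_tuple (h : Q -> Q -> Q -> Q -> Q) (v : 4.-tuple Q) :=
      h (tnth v (@Ordinal 4 0 isT)) (tnth v (@Ordinal 4 1 isT))
        (tnth v (@Ordinal 4 2 isT)) (tnth v (@Ordinal 4 3 isT)) in
    is_polynomial (at_tuple f) -> is_polynomial (at_tuple g) ->
    (forall b c d, f 1 b c d = g 1 b c d) ->
    (forall a c d, f a 1 c d = g a 1 c d) ->
    (forall a b d, f a b 1 d = g a b 1 d) ->
    (forall a b c, f a b c 1 = g a b c 1) ->
  forall a b c d, f a b c d = g a b c d.
Proof.
move=> at_tuple pf pg f1 f2 f3 f4 a b c d.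
apply: (supernilpotent_eq Q3 _ pf pg _ [tuple a; b; c; d]) => // v.
case=> [[|[|[|[|//]]]] lti] vi1; rewrite /at_tuple.
- by rewrite (_ : Ordinal _ = Ordinal lti) ?vi1 //; apply: val_inj.
- by rewrite (_ : @Ordinal 4 1 _ = Ordinal lti) ?vi1 //; apply: val_inj.
- by rewrite (_ : @Ordinal 4 2 _ = Ordinal lti) ?vi1 //; apply: val_inj.
- by rewrite (_ : @Ordinal 4 3 _ = Ordinal lti) ?vi1 //; apply: val_inj.
Qed.

(** * Families of inner maps that are the identity once a parameter is [1] *)

Section InnerFamily.

Variable F : Q -> Q -> Q -> Q.
Hypotheses (F_Mlt : forall a b, Mlt (F a b)) (F_poly : polynomial_op3 F).
Hypotheses (F1l : forall b u, F 1 b u = u) (F1r : forall a u, F a 1 u = u).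
Hypothesis F1 : forall a b, F a b 1 = 1.

(** Multiplicativity is tested in [a, b, x, y]: at [a = 1] or [b = 1] the map is the identity, and
    at [x = 1] or [y = 1] it suffices that [1] is fixed. *)
Lemma inner_family_automorphism a b : automorphism (F a b).
Proof.
have [g [_ FK gK]] := Mlt_bij (F_Mlt a b).
apply: automorphism_morph; first by exists g.
apply: (@supernilpotent3_eq (fun a b x y => F a b (x * y))
                            (fun a b x y => F a b x * F a b y)).
- by apply: F_poly; polynomiality.
- by apply: is_polynomial_mul; apply: F_poly; polynomiality.
- by move=> *; rewrite !F1l.
- by move=> *; rewrite !F1r.
- by move=> *; rewrite F1 !loopE.
- by move=> *; rewrite F1 !loopE.
Qed.

Lemma inner_family_center a b : center_Inn (F a b).
Proof.
split=> [|h [Mh h1] u]; first by split.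
(* For any [d], both sides equal [F a b x] at [c = 1] and [1] at [x = 1]. *)
have fL d c x : F a b ((d * c) \ (d * (c * x))) = (d * c) \ (d * (c * F a b x)).
  apply: (@supernilpotent3_eq
    (fun a b c x => F a b ((d * c) \ (d * (c * x))))
    (fun a b c x => (d * c) \ (d * (c * F a b x)))).
  - by apply: F_poly; polynomiality.
  - by polynomiality; apply: F_poly; polynomiality.
  - by move=> *; rewrite !F1l.
  - by move=> *; rewrite !F1r.
  - by move=> *; rewrite !loopE.
  - by move=> *; rewrite F1 !loopE F1.
have fR d c x : F a b ((d * c) \ ((d * x) * c)) = (d * c) \ ((d * F a b x) * c).
  apply: (@supernilpotent3_eq
    (fun a b c x => F a b ((d * c) \ ((d * x) * c)))
    (fun a b c x => (d * c) \ ((d * F a b x) * c))).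
  - by apply: F_poly; polynomiality.
  - by polynomiality; apply: F_poly; polynomiality.
  - by move=> *; rewrite !F1l.
  - by move=> *; rewrite !F1r.
  - by move=> *; rewrite !loopE.
  - by move=> *; rewrite F1 !loopE F1.
(* Since [h 1 = 1], the shifted map of [h] at base point [1] is [h] itself. *)
by have := Mlt_commute_shift fL fR Mh 1 u; rewrite h1 !loopE.
Qed.

End InnerFamily.

(* Covers commutators and associators alike: in an associator [[x, y, z]] the
   third entry [z] is absorbed into [G] as a constant. *)
Lemma innT_morph_absorbing (G : Q -> Q -> Q) :
    (forall n (f g : n.-tuple Q -> Q), is_polynomial f -> is_polynomial g ->
      is_polynomial (fun v => G (f v) (g v))) ->
    (forall y, G 1 y = 1) -> (forall x, G x 1 = 1) ->
  forall a x y c,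
    innT a (G x y * c) = innT a (G x y) * innT a c /\
    innT a (c * G x y) = innT a c * innT a (G x y).
Proof.
move=> G_poly G1l G1r a x y c; split.
(* At [a = 1] the map [innT a] is the identity; at [x = 1] or [y = 1] the factor [G x y] is [1]; at
   [c = 1] use that [innT a] fixes [1]. *)
- apply: (@supernilpotent3_eq (fun a x y c => innT a (G x y * c))
    (fun a x y c => innT a (G x y) * innT a c)); rewrite /innT.
  + by polynomiality; apply: G_poly; polynomiality.
  + by polynomiality; apply: G_poly; polynomiality.
  + by move=> *; rewrite !loopE.
  + by move=> *; rewrite G1l !loopE.
  + by move=> *; rewrite G1r !loopE.
  + by move=> *; rewrite !loopE.
- apply: (@supernilpotent3_eq (fun a x y c => innT a (c * G x y))
    (fun a x y c => innT a c * innT a (G x y))); rewrite /innT.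
  + by polynomiality; apply: G_poly; polynomiality.
  + by polynomiality; apply: G_poly; polynomiality.
  + by move=> *; rewrite !loopE.
  + by move=> *; rewrite G1l !loopE.
  + by move=> *; rewrite G1r !loopE.
  + by move=> *; rewrite !loopE.
Qed.

Lemma innT_morph_commutator a b c : is_commutator b ->
  innT a (b * c) = innT a b * innT a c /\ innT a (c * b) = innT a c * innT a b.
Proof.
move=> [t tP [x [y ->]]].
apply: (@innT_morph_absorbing (fun x y => term_value t [tuple x; y])).
- move=> n f g pf pg; apply: is_polynomial_term_value.
  by case=> [[|[|//]] ?].
(* The element [1] commutes with everything, so the term takes the value [1]. *)
- by move=> z; apply/tP; rewrite !loopE.
- by move=> z; apply/tP; rewrite !loopE.
Qed.

Lemma innT_morph_associator a b c : is_associator b ->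
  innT a (b * c) = innT a b * innT a c /\ innT a (c * b) = innT a c * innT a b.
Proof.
move=> [t tP [x [y [z ->]]]].
apply: (@innT_morph_absorbing (fun x y => term_value t [tuple x; y; z])).
- move=> n f g pf pg; apply: is_polynomial_term_value.
  by case=> [[|[|[|//]]] ?] //; apply: is_polynomial_cst.
(* A triple with [1] as an entry associates. *)
- by move=> u; apply/tP; rewrite !loopE.
- by move=> u; apply/tP; rewrite !loopE.
Qed.

End Supernilpotent3.

Theorem proposition6p1 (Q : loop) (Q3 : supernilpotent 3 Q) :
  [/\ forall a b : Q,
        [/\ automorphism (innL a b), automorphism (innR a b),
            automorphism (innM a b) & automorphism (innTT a b)],
      forall a b : Q,
        [/\ center_Inn (innL a b), center_Inn (innR a b),
            center_Inn (innM a b) & center_Inn (innTT a b)]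
    & forall a b c : Q,
        (is_commutator b \/ is_associator b) \/
        (is_commutator c \/ is_associator c) ->
        innT a (b * c) = innT a b * innT a c].
Proof.
(* Bundling the assumptions lets one check per family serve both (i) and (ii). *)
pose unital (F : Q -> Q -> Q -> Q) := [/\ forall a b, Mlt (F a b),
  polynomial_op3 F, forall b u, F 1 b u = u, forall a u, F a 1 u = u
  & forall a b, F a b 1 = 1].
have autF F a b : unital F -> automorphism (F a b).
  by case=> *; apply: inner_family_automorphism.
have centerF F a b : unital F -> center_Inn (F a b).
  by case=> *; apply: inner_family_center.
have uL : unital (@innL Q).
  split=> [|n f g h pf pg ph|b u|a u|a b]; rewrite /innL ?loopE //.
  - exact: Mlt_innL.
  - by polynomiality.
have uR : unital (@innR Q).
  split=> [|n f g h pf pg ph|b u|a u|a b]; rewrite /innR ?loopE //.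
  - exact: Mlt_innR.
  - by polynomiality.
have uM : unital (@innM Q).
  split=> [|n f g h pf pg ph|b u|a u|a b]; rewrite /innM ?loopE //.
  - exact: Mlt_innM.
  - by polynomiality.
have innT1 (u : Q) : innT 1 u = u by rewrite /innT !loopE.
have innTinv1 (u : Q) : innTinv 1 u = u by rewrite /innTinv !loopE.
have uT : unital (@innTT Q).
  split=> [|n f g h pf pg ph|b u|a u|a b]; first exact: Mlt_innTT.
  - by rewrite /innTT /innTinv /innT; polynomiality.
  (* When one of the two maps is the identity, the group commutator collapses to a map followed by
     its inverse. *)
  - by rewrite /innTT innTinv1 innT1 innTK.
  - by rewrite /innTT innTinv1 innT1 innTK.
  - by rewrite /innTT /innTinv /innT !loopE.
split=> [a b|a b|a b c]; [split; exact: autF | split; exact: centerF |].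
move=> [[]|[]] bc.
- exact: (innT_morph_commutator Q3 a c bc).1.
- exact: (innT_morph_associator Q3 a c bc).1.
- exact: (innT_morph_commutator Q3 a b bc).2.
- exact: (innT_morph_associator Q3 a b bc).2.
Qed.
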